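(* For $n\ge2$ and $i\ge1$ there are isomorphisms of $S_{n-1}$-representations $$\widehat{\mathrm{Lie}}^i_n\big\downarrow\ \cong\ \Big(\widehat{\mathrm{Lie}}^{i-1}_{n-1}\big\downarrow\ \oplus\ \widehat{\mathrm{Lie}}^{i-1}_{n-2}\Big)\big\uparrow,\qquad \widehat W^i_n\big\downarrow\ \cong\ \Big(\widehat W^{i-1}_{n-1}\big\downarrow\ \oplus\ \widehat W^{i-1}_{n-2}\Big)\big\uparrow,$$ where for an $S_m$-representation, $\downarrow$ denotes restriction to $S_{m-1}$ and $\uparrow$ denotes induction to $S_{m+1}$.
   Context: Let $C_n\subset S_n$ be generated by an $n$-cycle $c$, $\chi_\zeta$ a linear character of $C_n$ sending $c$ to a primitive $n$-th root of unity, $\mathrm{Lie}_{(n)}=\chi_\zeta\uparrow_{C_n}^{S_n}$, $\ell_n=\mathrm{ch}(\mathrm{Lie}_{(n)})$ (Frobenius characteristic), $\pi_n=\omega(\ell_n)$. For $\lambda=1^{m_1}2^{m_2}\cdots$ define $S_{|\lambda|}$-characters by $\mathrm{ch}(\mathrm{Lie}_\lambda)=\prod_j h_{m_j}[\ell_j]$ and $\mathrm{ch}(W_\lambda)=\prod_{j\text{ odd}}h_{m_j}[\pi_j]\prod_{j\text{ even}}e_{m_j}[\pi_j]$ (plethysm); $\mathrm{rank}(\lambda)=|\lambda|-\ell(\lambda)$. For $m,i\ge0$, $\widehat{\mathrm{Lie}}^i_m=\bigoplus_\lambda\mathrm{Lie}_\lambda$ and $\widehat W^i_m=\bigoplus_\lambda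 W_\lambda$, sums over partitions $\lambda$ of $m$ having no part equal to $1$ and rank $i$ (so $\widehat{\mathrm{Lie}}^0_0=\widehat W^0_0=\mathbf 1_{S_0}$, and $\widehat{\mathrm{Lie}}^i_1=\widehat W^i_1=0$). *)

(* Defs.v *)
From HB Require Import structures.
From mathcomp Require Import all_boot all_order all_algebra all_fingroup all_solvable all_field all_character.
Set Implicit Arguments. Unset Strict Implicit. Unset Printing Implicit Defensive.
Import Order.TTheory GRing.Theory Num.Theory.
Local Open Scope ring_scope.

(* ---------- Symmetric functions in the power-sum basis ----------
   A symmetric function is a finite formal sum  sum_t  t.1 * p_{t.2}
   (t.2 a multiset of positive integers, p_mu = prod_i p_{mu_i}).       *)
Definition SF := seq (algC * seq nat).

Definition coefSF (f : SF) (mu : seq nat) : algC :=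
  \sum_(t <- f | perm_eq t.2 mu) t.1.
Definition eqSF (f g : SF) : Prop := forall mu, coefSF f mu = coefSF g mu.

Definition oneSF : SF := [:: (1, [::])].
Definition addSF (f g : SF) : SF := f ++ g.
Definition scaleSF (c : algC) (f : SF) : SF := [seq (c * t.1, t.2) | t <- f].
Definition mulSF (f g : SF) : SF :=
  [seq (a.1 * b.1, a.2 ++ b.2) | a <- f, b <- g].
Definition prodSF (fs : seq SF) : SF := foldr mulSF oneSF fs.
Definition omegaSF (f : SF) : SF :=
  [seq ((-1) ^+ (sumn t.2 - size t.2)%N * t.1, t.2) | t <- f].
Definition pkPl (k : nat) (f : SF) : SF := [seq (t.1, [seq (k * x)%N | x <- t.2]) | t <- f].
Definition pnuPl (nu : seq nat) (f : SF) : SF := prodSF [seq pkPl k f | k <- nu].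

(* Cycle type of s, viewed as a permutation of {0,..,k-1} (s fixing the
   points >= k): multiset of the lengths of the cycles contained in [0,k). *)
Definition ctype N (k : nat) (s : {perm 'I_N}) : seq nat :=
  [seq #|X| | X : {set 'I_N} <- enum (porbits s) & X \subset [set i : 'I_N | (i < k)%N]].

(* S_k realised inside S_N as the pointwise stabiliser of {k,..,N-1} *)
Definition SymN N (k : nat) : {group {perm 'I_N}} :=
  ('C([set i : 'I_N | (k <= i)%N] | 'P))%G.

Definition frob N (k : nat) (chi : 'CF(SymN N k)) : SF :=
  [seq (chi s / #|SymN N k|%:R, ctype k s) | s <- enum (SymN N k)].

(* Inverse of the Frobenius characteristic: the class function of S_k whose
   Frobenius characteristic is f (f homogeneous of degree k). *)
Definition cfOf (gT : finGroupType) (G : {group gT}) (F : gT -> algC) : 'CF(G) :=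
  \sum_(xG in classes G) F (repr xG) *: '1_xG.
Definition chInv N (k : nat) (f : SF) : 'CF(SymN N k) :=
  cfOf (SymN N k) (fun s => #|SymN N k|%:R * coefSF f (ctype k s)
        / #|[set t in SymN N k | perm_eq (ctype k t) (ctype k s)]|%:R).

(* h_m[f] and e_m[f], using h_m = ch(1_{S_m}) and e_m = ch(sgn_{S_m}) *)
Definition hPl (m : nat) (f : SF) : SF :=
  flatten [seq scaleSF (#|SymN m m|%:R)^-1 (pnuPl (ctype m s) f) | s <- enum (SymN m m)].
Definition ePl (m : nat) (f : SF) : SF :=
  flatten [seq scaleSF ((-1) ^+ odd_perm s / #|SymN m m|%:R) (pnuPl (ctype m s) f)
          | s <- enum (SymN m m)].

Definition cyc (j : nat) : {perm 'I_j} := perm (@ordS_inj j).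
(* S_j = SymN j j is all of {perm 'I_j}; C_j = <[cyc j]>. *)
Definition LieChar (j : nat) : 'CF(SymN j j) :=
  match [pick i : Iirr <[cyc j]> | j.-primitive_root ('chi_i (cyc j))] with
  | Some i => 'Ind[SymN j j] 'chi_i
  | None => 0
  end.
Definition ell (j : nat) : SF := frob (LieChar j).
Definition piSF (j : nat) : SF := omegaSF (ell j).

Fixpoint allseqs (len m : nat) : seq (seq nat) :=
  if len is l.+1 then [seq k :: s | k <- iota 1 m, s <- allseqs l m] else [:: [::]].
Definition partitions (m : nat) : seq (seq nat) :=
  [seq l <- flatten [seq allseqs len m | len <- iota 0 m.+1]
     | sorted geq l && (sumn l == m)].

Definition chLie (lam : seq nat) : SF :=
  prodSF [seq hPl (count_mem j lam) (ell j) | j <- iota 1 (sumn lam)].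
Definition chW (lam : seq nat) : SF :=
  prodSF [seq (if odd j then hPl (count_mem j lam) (piSF j)
               else ePl (count_mem j lam) (piSF j)) | j <- iota 1 (sumn lam)].

Definition hatLam (i m : nat) : seq (seq nat) :=
  [seq lam <- partitions m | (1 \notin lam) && ((m - size lam)%N == i)].
Definition chHatLie (i m : nat) : SF := flatten [seq chLie lam | lam <- hatLam i m].
Definition chHatW (i m : nat) : SF := flatten [seq chW lam | lam <- hatLam i m].

Definition HatLie N (i m : nat) : 'CF(SymN N m) := chInv N m (chHatLie i m).
Definition HatW N (i m : nat) : 'CF(SymN N m) := chInv N m (chHatW i m).

Arguments SymN : clear implicits.
Arguments chInv : clear implicits.
Arguments HatLie : clear implicits.
Arguments HatW : clear implicits.

(* Main.v *)
Require Import Defs.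
From HB Require Import structures.
From mathcomp Require Import all_boot all_order all_algebra all_fingroup all_solvable all_field all_character.
From mathcomp Require Import mpoly zify.
Set Implicit Arguments. Unset Strict Implicit. Unset Printing Implicit Defensive.
Import Order.TTheory GRing.Theory Num.Theory.
Local Open Scope ring_scope.

(** Under the Frobenius characteristic, restriction is D = d/dp_1 and induction
    is multiplication by p_1.  The chain rule gives D(f[g]) = (D f)[g] * D g,
    and D h_m = h_(m-1), D e_m = e_(m-1).  A nontrivial power of an n-cycle has
    no fixed point, so D ell_j = D pi_j = p_1^(j-1).  Hence D acts on the product
    attached to lambda by removing one part j and multiplying by p_1^(j-1), and
    with H^i_m the characteristic of either family,
      D H^i_n = sum_(2 <= j <= i+1) p_1^(j-1) H^(i-j+1)_(n-j).
    Splitting off j = 2 gives D H^i_n = p_1 (D H^(i-1)_(n-1) + H^(i-1)_(n-2)). *)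

(** * The subgroups S_k of S_N and the cycle types of their elements *)

Lemma SymNP N k (s : {perm 'I_N}) :
  reflect (forall x : 'I_N, (k <= x)%N -> s x = x) (s \in SymN N k).
Proof.
apply: (iffP astabP) => [fixs x lekx | fixs x]; first by apply: fixs; rewrite inE.
by rewrite inE /= /aperm; apply: fixs.
Qed.

Lemma SymN_full N : SymN N N = [set: {perm 'I_N}] :> {set _}.
Proof. by apply/setP=> s; rewrite in_setT; apply/SymNP => x; rewrite leqNgt ltn_ord. Qed.

Lemma SymN_sub N k l : (k <= l)%N -> SymN N k \subset SymN N l.
Proof.
move=> lekl; apply/subsetP => s /SymNP fixs; apply/SymNP => x lelx.
by apply: fixs; apply: leq_trans lelx.
Qed.

Lemma SymN_step N k (b : 'I_N) (s : {perm 'I_N}) : b = k :> nat ->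
  s \in SymN N k.+1 -> (s \in SymN N k) = (s b == b).
Proof.
move=> bk /SymNP fixs; apply/SymNP/eqP => [-> // | sb x]; first by rewrite bk.
rewrite leq_eqVlt => /predU1P[kx | /fixs //].
by rewrite (_ : x = b) //; apply: val_inj; rewrite /= bk.
Qed.

Lemma SymN_lt N k (s : {perm 'I_N}) (x : 'I_N) :
  s \in SymN N k -> (s x < k)%N = (x < k)%N.
Proof.
move=> sS; have /SymNP fixV := groupVr sS; move/SymNP: sS => fixs.
apply/idP/idP; apply: contraTT; rewrite -!leqNgt => h; first by rewrite fixs.
by rewrite -(permK s x) fixV.
Qed.

(** Compares multisets of values along a bijection between finite sets of different types, as needed
    for cycle types of permutations of different ordinals. *)
Lemma perm_map_enum (S T : finType) (U : eqType) (A : {pred S}) (B : {pred T})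
    (g : S -> T) (F : S -> U) (G : T -> U) :
    {in A &, injective g} -> (forall y, (y \in B) = [exists x in A, y == g x]) ->
    (forall x, x \in A -> G (g x) = F x) ->
  perm_eq [seq G y | y <- enum B] [seq F x | x <- enum A].
Proof.
move=> ginj gB GF.
have -> : [seq F x | x <- enum A] = [seq G y | y <- [seq g x | x <- enum A]].
  by rewrite -map_comp; apply/eq_in_map => x; rewrite mem_enum /= => /GF.
apply/perm_map/uniq_perm; first exact: enum_uniq.
  by rewrite map_inj_in_uniq ?enum_uniq // => x y; rewrite !mem_enum; apply: ginj.
move=> y; rewrite mem_enum gB; apply/existsP/mapP => -[x].
  by case/andP=> xA /eqP ->; exists x; rewrite ?mem_enum.
by rewrite mem_enum => xA ->; exists x; rewrite xA eqxx.
Qed.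

Lemma ctypeE N k (s : {perm 'I_N}) : ctype k s =
  [seq #|X| | X : {set 'I_N} <-
    enum [pred X | (X \in porbits s) && (X \subset [set i : 'I_N | (i < k)%N])]].
Proof.
rewrite /ctype /= {1}/enum_mem -filter_predI.
by congr map; apply: eq_filter => X /=; rewrite andbC.
Qed.

Lemma porbit_conj N M (h : 'I_N -> 'I_M) (s : {perm 'I_N}) (t : {perm 'I_M}) x :
  (forall x, t (h x) = h (s x)) -> porbit t (h x) = h @: porbit s x.
Proof.
move=> hst; have hX i z : (t ^+ i)%g (h z) = h ((s ^+ i)%g z).
  by elim: i z => [|i IH] z; rewrite ?expg0 ?perm1 // !expgS !permM hst IH.
apply/setP => y; apply/porbitP/imsetP => [[i ->] | [z /porbitP[i ->] ->]].
  by exists ((s ^+ i)%g x); rewrite ?mem_porbit ?hX.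
by exists i.
Qed.

(** The map X |-> h @: X carries the cycles of [s] inside [0,k) bijectively to those of [t] and
    keeps their lengths. Both conjugation and the embedding of S_m into S_(m+1) are instances. *)
Lemma ctype_transport N M k (h : 'I_N -> 'I_M) (s : {perm 'I_N}) (t : {perm 'I_M}) :
    injective h -> (forall x, (h x < k)%N = (x < k)%N) ->
    (forall y : 'I_M, (y < k)%N -> exists x, y = h x) ->
    (forall x, t (h x) = h (s x)) ->
  perm_eq (ctype k t) (ctype k s).
Proof.
move=> hinj hk hsurj hst; rewrite !ctypeE.
apply: (perm_map_enum (g := fun X : {set 'I_N} => h @: X)) => [X Y _ _ | Y | X _].
- exact: imset_inj.
- rewrite inE; apply/andP/existsP => [[/imsetP[y _ ->] sub]|[X]].
    have /hsurj[x yx] : (y < k)%N by have := subsetP sub y (porbit_id t y); rewrite inE.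
    exists (porbit s x); rewrite yx (porbit_conj x hst) eqxx andbT inE imset_f //=.
    apply/subsetP => z xz; have := subsetP sub (h z).
    by rewrite !inE hk; apply; rewrite yx (porbit_conj x hst) imset_f.
  case/andP; rewrite inE => /andP[/imsetP[x _ ->] sub] /eqP ->; split.
    by rewrite -(porbit_conj x hst) imset_f.
  apply/subsetP => _ /imsetP[z xz ->]; rewrite inE hk.
  by have := subsetP sub z xz; rewrite inE.
- exact: card_imset.
Qed.

Lemma ctypeJ N k (s y : {perm 'I_N}) : y \in SymN N k ->
  perm_eq (ctype k (s ^ y)%g) (ctype k s).
Proof.
move=> yS; apply: (ctype_transport (h := y)) => [|x|z _|x].
- exact: perm_inj.
- exact: SymN_lt.
- by exists (y^-1%g z); rewrite permKV.
- by rewrite /conjg !permM permK.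
Qed.

Lemma ctype_lift m (s : {perm 'I_m}) :
  perm_eq (ctype m (lift_perm ord_max ord_max s)) (ctype m s).
Proof.
apply: (ctype_transport (h := lift ord_max)) => [|x|y ylt|x].
- exact: lift_inj.
- by rewrite lift_max.
- by exists (Ordinal ylt); apply: val_inj; rewrite /= /bump leqNgt ylt.
- by rewrite lift_perm_lift.
Qed.

Lemma porbit_fix (T : finType) (s : {perm T}) x : s x = x -> porbit s x = [set x].
Proof.
move=> sx; apply/setP => y; rewrite inE; apply/porbitP/eqP => [[i ->] | ->].
  by elim: i => [|i IH]; rewrite ?expg0 ?perm1 // expgS permM sx.
by exists 0%N; rewrite perm1.
Qed.

Lemma card_porbit1 (T : finType) (s : {perm T}) x : (#|porbit s x| == 1%N) = (s x == x).
Proof.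
apply/cards1P/eqP => [[y e] | /porbit_fix ->]; last by exists x.
have := porbit_id s x; have := mem_porbit s 1 x; rewrite e !inE expg1.
by move=> /eqP -> /eqP ->.
Qed.

Lemma count_ctype1 N k (s : {perm 'I_N}) :
  count_mem 1%N (ctype k s) = #|[set x : 'I_N | (x < k)%N && (s x == x)]|.
Proof.
rewrite ctypeE count_map -size_filter -filter_predI -[RHS](card_imset _ set1_inj).
rewrite cardE; congr size; apply: eq_filter => X /=.
apply/and3P/imsetP => [[/cards1P[x ->] /imsetP[y _ e] sub]|[x]].
  exists x => //; rewrite !inE; have := subsetP sub x; rewrite !inE eqxx => -> //=.
  rewrite -card_porbit1 (_ : porbit s x = [set x]) ?cards1 //.
  by rewrite e; apply/eqP; rewrite eq_porbit_mem -e inE.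
rewrite !inE => /andP[xk /eqP sx] ->; split; first by rewrite cards1.
  by rewrite -(porbit_fix sx) imset_f.
by rewrite sub1set inE.
Qed.

(** The point k is a cycle of its own, and every other cycle inside [0,k] avoids it. *)
Lemma ctypeS N k (s : {perm 'I_N}) : (k < N)%N -> s \in SymN N k ->
  perm_eq (ctype k.+1 s) (1%N :: ctype k s).
Proof.
move=> kN /SymNP fixs; pose b := Ordinal kN.
have pb : porbit s b = [set b] by apply/porbit_fix/fixs.
pose A := [pred X | (X \in porbits s) && (X \subset [set i : 'I_N | (i < k)%N])].
have bA : [set b] \notin A by rewrite inE sub1set inE ltnn andbF.
rewrite !ctypeE -/A -(cards1 b) -[_ :: _]/(map _ ([set b] :: enum A)).
apply/perm_map/uniq_perm; rewrite ?enum_uniq //= ?mem_enum ?bA ?enum_uniq // => X.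
rewrite in_cons !mem_enum !inE;
  apply/andP/orP => [[XP sub] | [/eqP -> | /andP[-> /subsetP sub]]].
- have [bX | bX] := boolP (b \in X).
    by left; case/imsetP: XP bX => x _ ->; rewrite -eq_porbit_mem => /eqP <-; rewrite pb.
  right; rewrite XP; apply/subsetP => x xX; rewrite inE.
  have := subsetP sub x xX; rewrite inE ltnS leq_eqVlt => /predU1P[xk|//].
  by rewrite (_ : x = b) ?(negbTE bX) // in xX; apply: val_inj.
- by rewrite -{1}pb imset_f // sub1set inE.
- by split => //; apply/subsetP => x /sub; rewrite !inE => /leqW.
Qed.

Lemma ctype_le N k (s : {perm 'I_N}) x : x \in ctype k s -> (x <= N)%N.
Proof.
rewrite ctypeE => /mapP[X _ ->]; rewrite -[leqRHS]card_ord; exact: max_card.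
Qed.

(** * Double counting of conjugates that fix the last point *)

(** These [y] form the coset of the stabiliser S_k of [b] translated by the transposition of [x] and
    [b]. *)
Lemma card_SymN_to N k (b : 'I_N) (x : 'I_N) : b = k :> nat -> (x <= k)%N ->
  #|[set y in SymN N k.+1 | y x == b]| = #|SymN N k|.
Proof.
move=> bk xk; rewrite -(card_lcoset (SymN N k) (tperm x b)); apply: eq_card => y.
rewrite inE mem_lcoset tpermV.
have tS : tperm x b \in SymN N k.+1.
  apply/SymNP => z lekz; rewrite tpermD //; apply: contraTneq lekz => <-;
    rewrite -ltnNge //.
  by rewrite bk.
have [yS | yS] /= := boolP (y \in SymN N k.+1).
  by have := SymN_step bk (groupM tS yS); rewrite permM tpermR => <-.
apply/esym/negbTE; apply: contra yS => /(subsetP (SymN_sub N (leqnSn k))).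
by rewrite groupMl.
Qed.

(** The conjugate of [s] by [y] fixes k exactly when [s] fixes the preimage x of k under [y].
    Sorting the [y] by x gives one coset of S_k for each fixed point x <= k. *)
Lemma card_SymN_conj N k (s : {perm 'I_N}) : (k < N)%N -> s \in SymN N k.+1 ->
  #|[set y in SymN N k.+1 | (s ^ y)%g \in SymN N k]|
    = (count_mem 1%N (ctype k.+1 s) * #|SymN N k|)%N.
Proof.
move=> kN sS; pose b := Ordinal kN; have bk : b = k :> nat by [].
rewrite count_ctype1 -sum1_card -sum_nat_const.
pose A := [set x : 'I_N | (x < k.+1)%N && (s x == x)].
rewrite (partition_big (fun y : {perm 'I_N} => y^-1%g b) (mem A)) /=.
  apply: eq_bigr => x; rewrite inE => /andP[xk /eqP sx].
  rewrite -(card_SymN_to bk xk) -sum1_card; apply: eq_bigl => y;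
    rewrite [X in X && _]in_set [RHS]in_set.
  have [yS | //] /= := boolP (y \in SymN N k.+1).
  rewrite (SymN_step bk) ?groupJ // andbC (canF_eq (permKV y)) [b == _]eq_sym.
  have [yx|] := eqVneq (y x) b; last by [].
  by rewrite /conjg !permM -yx permK sx eqxx.
move=> y; rewrite in_set => /andP[yS];
  rewrite (SymN_step bk) ?groupJ // /conjg !permM => e.
rewrite /= in_set SymN_lt ?groupV // bk leqnn /=.
by rewrite -(canF_eq (permK y)).
Qed.

(* Both sides are the sum of F (s ^ y) over the pairs (s, y) of elements of
   S_(k+1) such that s ^ y lies in S_k. *)
Lemma sum_SymN_fixed (V : nmodType) N k (F : {perm 'I_N} -> V) : (k < N)%N ->
    (forall s y, s \in SymN N k.+1 -> y \in SymN N k.+1 -> F (s ^ y)%g = F s) ->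
  (\sum_(s in SymN N k.+1) F s *+ count_mem 1%N (ctype k.+1 s)) *+ #|SymN N k|
    = (\sum_(s in SymN N k) F s) *+ #|SymN N k.+1|.
Proof.
move=> kN FJ; rewrite -[LHS]sumrMnl.
transitivity (\sum_(s in SymN N k.+1) \sum_(y in SymN N k.+1 | (s ^ y)%g \in SymN N k)
  F (s ^ y)%g).
  apply: eq_bigr => s sS; rewrite -mulrnA -card_SymN_conj // -sumr_const.
  apply: eq_big => y; first by rewrite [LHS]in_set.
  by rewrite in_set => /andP[yS _]; rewrite FJ.
rewrite (exchange_big_dep (mem (SymN N k.+1))) /=; last by move=> s y _ /andP[].
rewrite -sumr_const; apply: eq_bigr => y yS.
rewrite (reindex_inj (conjg_inj y^-1%g)) /=; apply: eq_big => s; rewrite conjgKV yS //=.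
rewrite groupJr ?groupV //; apply: andb_idl; apply/subsetP; exact: SymN_sub.
Qed.

(** Double counting leaves a sum over a stabiliser inside S_(m+1), while [hPl] and [ePl] sum over
    permutations of 'I_m; lifting by a fixed last point passes from one to the other. *)
Lemma sum_SymN_pred (V : nmodType) m (F : {perm 'I_m.+1} -> V) :
  \sum_(s in SymN m.+1 m) F s = \sum_(s in SymN m m) F (lift_perm ord_max ord_max s).
Proof.
pose g := @lift_perm m ord_max ord_max.
have ginj : injective g.
  move=> s t e; apply/permP => x; apply: (@lift_inj _ ord_max).
  by have := congr1 (fun u : {perm _} => u (lift ord_max x)) e;
    rewrite /g !lift_perm_lift.
rewrite SymN_full -(big_imset (h := g)) /=; last by move=> s t _ _; apply: ginj.
apply: eq_bigl => s; apply/idP/imsetP => [sS|[t _ ->]]; last first.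
  apply/SymNP => x mx; rewrite (_ : x = ord_max) ?lift_perm_id //.
  by apply/val_inj/eqP; rewrite eqn_leq mx andbT -ltnS ltn_ord.
(* The preimage of [s] under the lift is its restriction [t0] to the first m points. *)
have smax : s ord_max = ord_max by move/SymNP: sS; apply.
have tP (x : 'I_m) : (s (lift ord_max x) < m)%N by rewrite SymN_lt // lift_max.
pose t0 x := Ordinal (tP x).
have t0inj : injective t0.
  move=> x y /(congr1 val) /= e; apply: (@lift_inj _ ord_max); apply: (@perm_inj _ s);
    exact: val_inj.
exists (perm t0inj); first by rewrite in_setT.
apply/permP => x; have [y ->|->] := unliftP ord_max x.
  by rewrite lift_perm_lift permE; apply: val_inj; rewrite /= /bump leqNgt tP.
by rewrite lift_perm_id.
Qed.

Lemma card_SymN_pred m : #|SymN m.+1 m| = #|SymN m m|.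
Proof. by rewrite -!sum1_card; exact: (sum_SymN_pred (fun=> 1%N)). Qed.

(** * Symmetric functions as polynomials in the power sums, and the derivation D = d/dp_1 *)

Lemma perm_rem (T : eqType) (x : T) s t : perm_eq s t -> perm_eq (rem x s) (rem x t).
Proof.
by move=> st; apply/seq.permP => a; rewrite !count_rem (seq.permP st) (perm_mem st).
Qed.

(* 'X_x stands for p_x; power sums of index at least k.+2 are sent to 0, so ev
   below is faithful only on the coefficients at mu with all parts < k.+2. *)
Definition psum k (x : nat) : {mpoly algC[k.+2]} :=
  if insub x is Some i then 'X_i else 0.
Definition evm k (mu : seq nat) : {mpoly algC[k.+2]} := \prod_(x <- mu) psum k x.
Definition ev k (f : SF) : {mpoly algC[k.+2]} := \sum_(t <- f) t.1 *: evm k t.2.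

(** Having [k.+2] variables ensures that p_1 is always among them. *)
Definition idx1 k : 'I_k.+2 := Ordinal (isT : (1 < k.+2)%N).
Local Notation "''D' p" := (mderiv (idx1 _) p) (at level 10, p at level 8).

Lemma evm_perm k mu nu : perm_eq mu nu -> evm k mu = evm k nu.
Proof. exact: perm_big. Qed.

Lemma ev_cat k f g : ev k (f ++ g) = ev k f + ev k g.
Proof. exact: big_cat. Qed.

Lemma ev_flatten (I : Type) k (s : seq I) (G : I -> SF) :
  ev k (flatten [seq G l | l <- s]) = \sum_(l <- s) ev k (G l).
Proof.
elim: s => [|l s IH] /=; first by rewrite big_nil /ev big_nil.
by rewrite ev_cat big_cons IH.
Qed.

Lemma ev_scale k c f : ev k (scaleSF c f) = c *: ev k f.
Proof. by rewrite /ev big_map scaler_sumr; apply: eq_bigr => t _; rewrite scalerA. Qed.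

Lemma ev_one k : ev k oneSF = 1.
Proof. by rewrite /ev big_seq1 /evm big_nil scale1r. Qed.

Lemma ev_mul k f g : ev k (mulSF f g) = ev k f * ev k g.
Proof.
rewrite /ev /mulSF big_allpairs_dep mulr_suml; apply: eq_bigr => a _.
rewrite mulr_sumr; apply: eq_bigr => b _ /=.
by rewrite /evm big_cat /= -scalerAl -scalerAr scalerA.
Qed.

Lemma ev_prod k fs : ev k (prodSF fs) = \prod_(f <- fs) ev k f.
Proof.
by elim: fs => [|f fs IH]; rewrite ?big_nil ?ev_one // big_cons /= ev_mul IH.
Qed.

Lemma ev_pnuPl k nu f : ev k (pnuPl nu f) = \prod_(l <- nu) ev k (pkPl l f).
Proof. by rewrite ev_prod big_map. Qed.

Lemma ev_pnuPl_perm k mu nu f : perm_eq mu nu -> ev k (pnuPl mu f) = ev k (pnuPl nu f).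
Proof. by rewrite !ev_pnuPl; apply: perm_big. Qed.

Lemma ev_pkPl1 k f : ev k (pkPl 1 f) = ev k f.
Proof.
rewrite /ev big_map; apply: eq_bigr => t _ /=.
by rewrite (eq_map (mul1n)) map_id.
Qed.

Lemma D_psum k x : 'D (psum k x) = (x == 1%N)%:R.
Proof.
rewrite /psum; case: insubP => [i _ <-|xk]; last by rewrite raddf0; case: eqP xk => // ->.
rewrite mderivX mnm1E -[(_ : nat) == 1%N]/(i == idx1 k).
have [->|] := eqVneq i (idx1 k); rewrite ?scale0r // scale1r -mpolyX0; congr 'X_[_].
by apply/mnmP => j; rewrite !mnmE subnn.
Qed.

Lemma D_evm k mu : 'D (evm k mu) = evm k (rem 1%N mu) *+ count_mem 1%N mu.
Proof.
elim: mu => [|x mu IH]; first by rewrite /evm big_nil -mpolyC1 mderivC mulr0n.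
rewrite {1}/evm big_cons -/(evm k mu) mderivM IH D_psum /=.
have [-> | x1] := eqVneq x 1%N; last by rewrite /evm big_cons mul0r !add0r mulrnAr add0n.
rewrite mul1r mulrnAr add1n mulrS; congr (_ + _).
have [mu1|] := boolP (1%N \in mu); last by move/count_memPn ->.
by rewrite (evm_perm _ (perm_to_rem mu1)) /evm big_cons.
Qed.

Lemma D_ev k f :
  'D (ev k f) = \sum_(t <- f) t.1 *: (evm k (rem 1%N t.2) *+ count_mem 1%N t.2).
Proof. by rewrite linear_sum /=; apply: eq_bigr => t _; rewrite mderivZ D_evm. Qed.

(** All indices occurring in p_l[f] are multiples of l, so p_1 does not occur. *)
Lemma D_ev_pkPl k l f : l != 1%N -> 'D (ev k (pkPl l f)) = 0.
Proof.
move=> l1; rewrite D_ev big_map big1_seq // => t _ /=.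
rewrite (_ : count_mem _ _ = 0%N) ?scaler0 //; apply/count_memPn/mapP => -[x _].
by move/esym/eqP; rewrite muln_eq1 (negbTE l1).
Qed.

(** The chain rule for p_nu[f]: in the Leibniz expansion only the factors p_1[f] = f have a nonzero
    derivative. *)
Lemma D_ev_pnuPl k nu f :
  'D (ev k (pnuPl nu f)) =
    (ev k (pnuPl (rem 1%N nu) f) * 'D (ev k f)) *+ count_mem 1%N nu.
Proof.
elim: nu => [|x nu IH]; first by rewrite ev_pnuPl big_nil -mpolyC1 mderivC mulr0n.
rewrite [pnuPl _ _]/= ev_mul mderivM IH /=.
have [-> | x1] := eqVneq x 1%N; last first.
  by rewrite D_ev_pkPl // mul0r add0r add0n [pnuPl (_ :: _) _]/= ev_mul mulrnAr mulrA.
rewrite ev_pkPl1 mulrC add1n mulrS mulrnAr; congr (_ + _).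
have [mu1|] := boolP (1%N \in nu); last by move/count_memPn ->.
by rewrite mulrA (ev_pnuPl_perm _ _ (perm_to_rem mu1)) [in RHS]ev_mul ev_pkPl1.
Qed.

(** * Reading off coefficients, and the effect on them of D and of multiplication by p_1 *)

Definition mnm_type k (mu : seq nat) : 'X_{1..k.+2} :=
  [multinom count_mem (val i) mu | i < k.+2].

Lemma evmE k mu : all (fun x => x < k.+2)%N mu -> evm k mu = 'X_[mnm_type k mu].
Proof.
elim: mu => [_|x mu IH /= /andP[xk /IH]].
  by rewrite /evm big_nil -mpolyX0; congr 'X_[_].
rewrite /evm big_cons => ->; rewrite /psum insubT -mpolyXD; congr 'X_[_].
by apply/mnmP => i; rewrite !mnmE.
Qed.

Lemma evm_coef k mu nu : all (fun x => x < k.+2)%N nu ->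
  (evm k mu)@_(mnm_type k nu) = (perm_eq mu nu)%:R.
Proof.
move=> nuk; have [muk|] := boolP (all (fun x => x < k.+2)%N mu).
  rewrite evmE // mcoeffX; congr (nat_of_bool _)%:R; apply/eqP/idP => [e|/seq.permP e].
    apply/allP => x xmn; have xk : (x < k.+2)%N.
      by move: xmn; rewrite mem_cat => /orP[/(allP muk)|/(allP nuk)].
    by have := congr1 (fun m : 'X_{1..k.+2} => m (Ordinal xk)) e; rewrite !mnmE /= => ->.
  by apply/mnmP => i; rewrite !mnmE e.
(* A part of [mu] beyond the available variables sends p_mu to 0, and it also prevents [mu] from
   being a rearrangement of the bounded [nu]. *)
rewrite -has_predC => /hasP[x xmu /= xk].
rewrite /evm (big_rem x) //= /psum insubN // mul0r mcoeff0.
by case: (boolP (perm_eq mu nu)) => // /perm_mem e; move: xmu xk;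
  rewrite e => /(allP nuk) ->.
Qed.

Lemma ev_coef k f mu : all (fun x => x < k.+2)%N mu ->
  coefSF f mu = (ev k f)@_(mnm_type k mu).
Proof.
move=> muk; rewrite /coefSF /ev linear_sum big_mkcond /=; apply: eq_bigr => t _.
by rewrite mcoeffZ evm_coef //; case: ifP; rewrite ?mulr1 ?mulr0.
Qed.

Lemma coefSF_perm f mu nu : perm_eq mu nu -> coefSF f mu = coefSF f nu.
Proof. by move/permPr => e; apply: eq_bigl => t; rewrite e. Qed.

Lemma coef_D k f mu : all (fun x => x < k.+2)%N mu ->
  ('D (ev k f))@_(mnm_type k mu) = coefSF f (1%N :: mu) *+ (count_mem 1%N mu).+1.
Proof.
move=> muk; rewrite mcoeff_mderiv (ev_coef (k := k)) /= ?muk // mnmE; congr (_@_ _ *+ _).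
by apply/mnmP => i; rewrite !mnmE addnC.
Qed.

Lemma coef_mulp1 k (p : {mpoly algC[k.+2]}) mu :
  (psum k 1 * p)@_(mnm_type k mu) =
    if 1%N \in mu then p@_(mnm_type k (rem 1%N mu)) else 0.
Proof.
rewrite mulrC (_ : psum k 1 = 'X_[U_(idx1 k)]); last first.
  by rewrite /psum insubT; congr 'X_[U_(_)]; apply: val_inj.
case: ifP => mu1.
  rewrite (_ : mnm_type k mu = U_(idx1 k) + mnm_type k (rem 1%N mu))%MM ?mcoeffMX //.
  by apply/mnmP => i; rewrite !mnmE (seq.permP (perm_to_rem mu1)).
rewrite mcoeffM big1 // => -[a b] /= /eqP e; rewrite mcoeffX.
have [eb|] := eqVneq; last by rewrite mulr0.
have := congr1 (fun m : 'X_{1..k.+2} => m (idx1 k)) e.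
by rewrite -eb !mnmE eqxx addn1 /= => /esym/eqP; rewrite (count_memPn _) ?mu1.
Qed.

(** * Differentiating h_m[f] and e_m[f] *)

(** One flag lets the trivial and the sign character be handled by the same argument. *)
Definition signed_pl (b : bool) m f := if b then ePl m f else hPl m f.

Lemma ev_signed_pl k b m f : ev k (signed_pl b m f) =
  (#|SymN m m|%:R)^-1 *:
    \sum_(s in SymN m m) (-1) ^+ (b && odd_perm s) *: ev k (pnuPl (ctype m s) f).
Proof.
rewrite scaler_sumr -big_enum /=; case: b; rewrite ev_flatten; apply: eq_bigr => s _.
  by rewrite ev_scale scalerA mulrC.
by rewrite ev_scale scale1r.
Qed.

Lemma ev_signed_pl0 k b f : ev k (signed_pl b 0 f) = 1.
Proof.
have p1 (s : {perm 'I_0}) : s = 1%g by apply/permP => -[].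
have S1 : SymN 0 0 = [set 1%g] :> {set _}.
  by apply/setP => s; rewrite SymN_full in_setT in_set1 (p1 s) eqxx.
rewrite ev_signed_pl S1 cards1 invr1 scale1r big_set1.
rewrite odd_perm1 andbF scale1r (_ : ctype _ _ = [::]) ?ev_one //.
apply: size0nil; rewrite ctypeE size_map -cardE; apply: eq_card0 => X.
rewrite !inE; apply/negbTE/andP => -[/imsetP[[]]]; by [].
Qed.

(** The chain rule on each p_nu[f] produces the number of fixed points as a weight; double counting
    turns the weighted average over S_(m+1) into the average over S_m. *)
Lemma D_signed_pl k b m f :
  'D (ev k (signed_pl b m.+1 f)) = ev k (signed_pl b m f) * 'D (ev k f).
Proof.
have cS n : #|SymN n n|%:R != 0 :> algC by rewrite pnatr_eq0 -lt0n cardG_gt0.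
pose F (s : {perm 'I_m.+1}) :=
  (-1) ^+ (b && odd_perm s) *: ev k (pnuPl (rem 1%N (ctype m.+1 s)) f).
have FJ s y : s \in SymN m.+1 m.+1 -> y \in SymN m.+1 m.+1 -> F (s ^ y)%g = F s.
  move=> sS yS; rewrite /F odd_permJ; congr (_ *: _); apply: ev_pnuPl_perm.
  by apply: perm_rem; apply: ctypeJ.
have := sum_SymN_fixed (leqnn m.+1) FJ.
rewrite sum_SymN_pred card_SymN_pred => e.
rewrite !ev_signed_pl mderivZ (raddf_sum (mderiv (idx1 k))) /=.
transitivity ((#|SymN m.+1 m.+1|%:R)^-1 *:
    (\sum_(s in SymN m.+1 m.+1) F s *+ count_mem 1%N (ctype m.+1 s)) * 'D (ev k f)).
  rewrite -scalerAl mulr_suml; congr (_ *: _); apply: eq_bigr => s _.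
  by rewrite mderivZ D_ev_pnuPl /F mulrnAl -scalerAl scalerMnr.
congr (_ * _); apply: (scalerI (cS m)); rewrite [RHS]scalerA mulfV // scale1r.
rewrite scalerA mulrC -scalerA scaler_nat e -scaler_nat scalerA mulVf // scale1r.
(* Lifting keeps the parity, and the part 1 that it adds to the cycle type is the one that [rem]
   deletes. *)
apply: eq_bigr => s _; rewrite /F odd_lift_perm addbb addFb; congr (_ *: _).
apply: ev_pnuPl_perm; set t := lift_perm _ _ _.
have tS : t \in SymN m.+1 m.
  apply/SymNP => x mx; rewrite (_ : x = ord_max) ?lift_perm_id //.
  by apply/val_inj/eqP; rewrite eqn_leq mx andbT -ltnS ltn_ord.
apply: perm_trans (perm_rem _ (ctypeS (leqnn _) tS)) _; rewrite /=.
exact: ctype_lift.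
Qed.

(** * The derivatives of ell_j and pi_j *)

Definition signed_omega (b : bool) f := if b then omegaSF f else f.

Lemma ctype_one j : ctype j (1 : {perm 'I_j})%g = nseq j 1%N.
Proof.
have all1 : all (pred1 1%N) (ctype j (1 : {perm 'I_j})%g).
  apply/allP => x; rewrite ctypeE => /mapP[X];
    rewrite mem_enum inE => /andP[/imsetP[y _ ->] _] ->.
  by rewrite /= card_porbit1 perm1.
have c1 : count_mem 1%N (ctype j (1 : {perm 'I_j})%g) = j.
  rewrite count_ctype1 -[RHS]card_ord -[RHS]cardsT; apply: eq_card => x.
  by rewrite !inE perm1 eqxx ltn_ord.
by rewrite (all_pred1P _ _ all1); move: all1; rewrite all_count c1 => /eqP <-.
Qed.

(** D kills p_mu when mu has no part 1, and [chi] kills the remaining nontrivial elements. The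
    identity is left: its cycle type is 1^(j+1), omega acts on it by sign 1, and D p_1^(j+1) = (j+1)
    p_1^j. *)
Lemma D_signed_omega_frob k b j (chi : 'CF(SymN j.+1 j.+1)) :
    (forall (s : {perm 'I_j.+1}) x, s x = x -> s != 1%g -> chi s = 0) ->
  'D (ev k (signed_omega b (frob chi)))
    = (chi 1%g / #|SymN j.+1 j.+1|%:R * j.+1%:R) *: psum k 1 ^+ j.
Proof.
move=> chi0; rewrite D_ev.
transitivity (\sum_(s in SymN j.+1 j.+1)
    ((if b then (-1) ^+ (sumn (ctype j.+1 s) - size (ctype j.+1 s))%N else 1)
       * (chi s / #|SymN j.+1 j.+1|%:R))
      *: (evm k (rem 1%N (ctype j.+1 s)) *+ count_mem 1%N (ctype j.+1 s))).
  rewrite -big_enum /=; case: b; rewrite /= /frob ?big_map; apply: eq_bigr => s _ //=.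
  by rewrite mul1r.
rewrite (big_setD1 1%g) ?group1 //= [X in _ + X]big1 => [|s]; last first.
  rewrite in_setD1 => /andP[s1 _].
  have [/eqP|] := eqVneq (count_mem 1%N (ctype j.+1 s)) 0%N.
    by move/eqP ->; rewrite mulr0n scaler0.
  rewrite count_ctype1 cards_eq0 => /set0Pn[x]; rewrite inE => /andP[_ /eqP sx].
  by rewrite (chi0 s x) // mul0r mulr0 scale0r.
rewrite addr0 ctype_one sumn_nseq size_nseq mul1n subnn expr0 if_same mul1r /=.
rewrite count_nseq /= mul1n -scaler_nat scalerA; congr (_ *: _).
by rewrite /evm big_nseq -Monoid.iteropE.
Qed.

Lemma cycXE j i (x : 'I_j) : ((cyc j ^+ i)%g x : nat) = ((x + i) %% j)%N.
Proof.
elim: i => [|i IH]; first by rewrite expg0 perm1 addn0 modn_small.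
by rewrite expgSr permM /cyc permE /= IH -addn1 modnDml addn1 addnS.
Qed.

(** The power is the rotation by i, and a rotation with a fixed point has i divisible by j. *)
Lemma cycX_fix j i (x : 'I_j) : (cyc j ^+ i)%g x = x -> (cyc j ^+ i)%g = 1%g.
Proof.
move/(congr1 val); rewrite /= cycXE => e; apply/permP => y; apply: val_inj.
rewrite /= cycXE perm1; have : (x + i == x + 0 %[mod j])%N by rewrite e addn0 modn_small.
by rewrite eqn_modDl => /eqP ei; rewrite -modnDmr ei modnDmr addn0 modn_small.
Qed.

Lemma order_cyc j : #[cyc j.+1]%g = j.+1.
Proof.
apply/eqP; rewrite eqn_dvd order_dvdn; apply/andP; split.
  by apply/eqP/permP => x; apply: val_inj; rewrite /= cycXE perm1 modnDr modn_small.
have /(congr1 (fun s : {perm _} => val (s ord0))) := expg_order (cyc j.+1).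
by rewrite /= cycXE perm1 /= add0n => /eqP.
Qed.

(** Evaluation at the generator embeds the irreducible characters into the roots of unity of order
    dividing that of [x]. Both sets have the same size, so a primitive root is attained. *)
Lemma cycle_irr_prim (gT : finGroupType) (x : gT) :
  exists i : Iirr <[x]>%g, #[x]%g.-primitive_root ('chi_i x).
Proof.
have [z zP] := C_prim_root_exists (order_gt0 x).
have linP (i : Iirr <[x]>%g) : 'chi_i \is a linear_char by
  apply/irr_cyclic_lin/cycle_cyclic.
have rootP (i : Iirr <[x]>%g) : {k : 'I_(#[x]%g) | 'chi_i x = z ^+ k}.
  apply: (prim_rootP zP); rewrite -lin_charX ?cycle_id // expg_order; exact: lin_char1.
pose f i := sval (rootP i).
have finj : injective f.
  move=> i j e; apply/irr_inj/cfun_inP => _ /cycleP[l ->].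
  rewrite !lin_charX ?cycle_id //; congr (_ ^+ _).
  by rewrite (svalP (rootP i)) (svalP (rootP j)) -/(f i) e.
have cardI : #|'I_(#[x]%g)| = #|Iirr <[x]>%g|.
  rewrite !card_ord NirrE; have := cycle_abelian x;
    rewrite card_classes_abelian => /eqP ->.
  by [].
have [g _ gK] : bijective f by apply: (inj_card_bij finj); rewrite cardI.
(* The exponent 1 is reduced modulo the order to cover trivial [x], where the only exponent is 0. *)
exists (g (Ordinal (ltn_pmod 1 (order_gt0 x)))).
by rewrite (svalP (rootP _)) -/(f _) gK /= prim_expr_mod.
Qed.

(** A suitable character exists, so [LieChar] never takes its default value 0 here. *)
Lemma LieCharP j : exists2 i : Iirr <[cyc j.+1]>%g,
  'chi_i \is a linear_char & LieChar j.+1 = 'Ind[SymN j.+1 j.+1] 'chi_i.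
Proof.
rewrite /LieChar; case: pickP => [i _|no].
  by exists i => //; apply/irr_cyclic_lin/cycle_cyclic.
have [i iP] := cycle_irr_prim (cyc j.+1).
by have := no i; rewrite -{1}[j.+1]order_cyc iP.
Qed.

Lemma D_signed_ell k b j :
  'D (ev k (signed_omega b (ell j.+1))) = psum k 1 ^+ j.
Proof.
have [i lin_i LieE] := LieCharP j.
have sub : (<[cyc j.+1]>%g \subset SymN j.+1 j.+1) by rewrite SymN_full subsetT.
rewrite D_signed_omega_frob LieE => [|s x sx s1].
  (* The degree of the induced character is the index of the cyclic group, of order j+1, so the
     coefficient is 1. *)
  rewrite cfInd1 // lin_char1 // mulr1 -[in X in _ * X]order_cyc -mulrA mulrCA -natrM.
  rewrite mulnC Lagrange // mulVf ?scale1r // pnatr_eq0 -lt0n cardG_gt0 //.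
(* A conjugate of [x] still has a fixed point; if it were a power of the cycle, it would be
   trivial. *)
rewrite cfIndE // big1 ?mulr0 // => y _; apply: cfun0; apply: contra s1 => /cycleP[l e].
rewrite -(conjg_eq1 s y) e; apply/eqP/(cycX_fix (x := y x)).
by rewrite -e /conjg !permM permK sx.
Qed.

(** * Partitions without parts 1, and removal of one part *)

Lemma allseqsP len m lam :
  (lam \in allseqs len m) = (size lam == len) && all (fun x => 0 < x <= m)%N lam.
Proof.
elim: len lam => [|len IH] lam /=; first by rewrite inE; case: lam.
apply/allpairsP/idP => [[[x s] /= [xm]]|].
  rewrite IH => /andP[/eqP szs alls] -> /=; rewrite szs eqxx alls andbT /=.
  by move: xm; rewrite mem_iota add1n ltnS.
case: lam => [|x s] //= /andP[sz /andP[xm alls]]; exists (x, s) => /=.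
by rewrite IH mem_iota add1n ltnS alls andbT -eqSS.
Qed.

Lemma allseqs_uniq len m : uniq (allseqs len m).
Proof.
elim: len => [|len IH] //=; apply: allpairs_uniq => //; first exact: iota_uniq.
by move=> [x s] [y t] _ _ /= [-> ->].
Qed.

Lemma mem_sumn (s : seq nat) x : x \in s -> (x <= sumn s)%N.
Proof. by move=> xs; rewrite (perm_sumn (perm_to_rem xs)) /= leq_addr. Qed.

Lemma size_sumn (s : seq nat) : 0%N \notin s -> (size s <= sumn s)%N.
Proof.
elim: s => //= x s IH; rewrite in_cons negb_or eq_sym -lt0n => /andP[x0 /IH].
by rewrite -add1n; apply: leq_add.
Qed.

Lemma partitionsP m lam :
  (lam \in partitions m) = [&& sorted geq lam, sumn lam == m & 0%N \notin lam].
Proof.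
rewrite mem_filter -andbA; apply: andb_id2l => _; apply: andb_id2l => /eqP sm.
apply/flatten_mapP/idP => [[len _]|lam0].
  rewrite allseqsP => /andP[_ /allP all0]; apply/negP => /all0; by [].
exists (size lam); first by rewrite mem_iota add0n ltnS -sm size_sumn.
rewrite allseqsP eqxx; apply/allP => x xs; rewrite -sm mem_sumn // andbT lt0n.
by apply: contraNneq lam0 => <-.
Qed.

Lemma partitions_uniq m : uniq (partitions m).
Proof.
apply: filter_uniq; have := iota_uniq 0 m.+1.
elim: (iota 0 m.+1) => //= len s IH /andP[lens /IH us].
rewrite cat_uniq allseqs_uniq us andbT; apply/hasPn => lam /flatten_mapP[l ls].
rewrite allseqsP => /andP[/eqP szl _]; rewrite /= allseqsP szl.
by apply/negP => /andP[/eqP ll _]; rewrite -ll ls in lens.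
Qed.

Lemma hatLamP i m lam : (lam \in hatLam i m) =
  [&& sorted geq lam, 0%N \notin lam, 1%N \notin lam, sumn lam == m
    & (m - size lam)%N == i].
Proof.
rewrite mem_filter partitionsP.
by case: (sorted _ _); case: (0%N \in lam); case: (1%N \in lam); case: (sumn lam == m);
  rewrite ?andbF ?andbT.
Qed.

Lemma hatLam_uniq i m : uniq (hatLam i m).
Proof. exact/filter_uniq/partitions_uniq. Qed.

Lemma geq_trans : transitive geq.
Proof. by move=> x y z /= xy yz; apply: leq_trans yz xy. Qed.

Lemma geq_total : total geq.
Proof. by move=> x y; apply: leq_total. Qed.

Lemma geq_anti : antisymmetric geq.
Proof. by move=> x y /=; rewrite andbC => /anti_leq. Qed.

(** Removing a part l+1 lowers the size by l+1 and the length by 1, hence the rank by l. The inverse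
    inserts the part and sorts. *)
Lemma hatLam_rem i m l : (0 < l)%N -> (l <= i)%N -> (l < m)%N ->
  perm_eq [seq rem l.+1 lam | lam <- hatLam i m & l.+1 \in lam]
          (hatLam (i - l) (m - l.+1)).
Proof.
move=> l0 li lm; apply: uniq_perm.
- rewrite map_inj_in_uniq => [|s t]; first exact/filter_uniq/hatLam_uniq.
  rewrite mem_filter hatLamP => /andP[ls /andP[ss _]].
  rewrite mem_filter hatLamP => /andP[lt /andP[st _]] e.
  apply: (sorted_eq geq_trans geq_anti) => //.
  by rewrite (permPl (perm_to_rem ls)) (permPr (perm_to_rem lt)) e.
- exact: hatLam_uniq.
move=> mu; rewrite hatLamP; apply/mapP/idP => [[lam]|].
  rewrite mem_filter hatLamP => /andP[ll /and5P[sl l0' l1 /eqP sm /eqP rk] ->].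
  have sub := @mem_rem _ l.+1 lam.
  have sme : sumn lam = (l.+1 + sumn (rem l.+1 lam))%N.
    by rewrite (perm_sumn (perm_to_rem ll)).
  have sz : (size lam).-1.+1 = size lam by case: (lam) ll.
  apply/and5P; split.
  - by apply: (subseq_sorted geq_trans (rem_subseq _ _)).
  - by apply: contra l0' => /sub.
  - by apply: contra l1 => /sub.
  - by rewrite -sm sme addKn.
  by rewrite size_rem //; apply/eqP; lia.
case/and5P=> smu mu0 mu1 /eqP summu /eqP rk.
pose lam := sort geq (l.+1 :: mu).
have pl : perm_eq lam (l.+1 :: mu) by rewrite perm_sort.
have ll : l.+1 \in lam by rewrite (perm_mem pl) mem_head.
exists lam.
  rewrite mem_filter ll hatLamP (sort_sorted geq_total) !(perm_mem pl) !in_cons /=.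
  rewrite (negbTE mu0) (negbTE mu1) eqSS (ltn_eqF l0) (perm_sumn pl) /= summu subnKC //
    eqxx /=.
  have -> : size lam = (size mu).+1 by exact: perm_size pl.
  move: (size_sumn mu0) rk; rewrite summu; move: (size mu) => n.
  by clear -l0 li lm; move=> ? ?; apply/eqP; lia.
apply: (sorted_eq geq_trans geq_anti) => //.
  by apply: (subseq_sorted geq_trans (rem_subseq _ _)); rewrite (sort_sorted geq_total).
by have := perm_rem l.+1 pl; rewrite /= eqxx perm_sym.
Qed.

(** A part l+1 contributes l to the rank and the other parts contribute nonnegative amounts; l > 0
    because parts 1 are excluded. *)
Lemma hatLam_rank i m l lam : lam \in hatLam i m -> l.+1 \in lam ->
  (0 < l <= i)%N /\ (l < m)%N.
Proof.
rewrite hatLamP => /and5P[_ l0 l1 /eqP sm /eqP <-] ll.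
have -> : (0 < l)%N by case: (posnP l) ll l1 => // -> ->.
have lm : (l < m)%N by rewrite -sm mem_sumn.
split=> //=; rewrite -sm.
have -> : sumn lam = (l.+1 + sumn (rem l.+1 lam))%N.
  by rewrite (perm_sumn (perm_to_rem ll)).
have -> : size lam = (size (rem l.+1 lam)).+1 by rewrite (perm_size (perm_to_rem ll)).
have : 0%N \notin rem l.+1 lam by apply: contra l0 => /mem_rem.
by move/size_sumn; move: (size _) (sumn _) => a b ab; lia.
Qed.

(** * The derivative of the characteristics of both families *)

(* The flag w selects the family: false for Lie, true for W. *)
Definition factor w j m : SF := signed_pl (w && ~~ odd j) m (signed_omega w (ell j)).
Definition chG w lam : SF :=
  prodSF [seq factor w j (count_mem j lam) | j <- iota 1 (sumn lam)].
Definition chHatG w i m : SF := flatten [seq chG w lam | lam <- hatLam i m].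

Lemma chHatG_Lie i m : chHatG false i m = chHatLie i m.
Proof. by []. Qed.

Lemma chHatG_W i m : chHatG true i m = chHatW i m.
Proof.
congr flatten; apply: eq_map => lam; congr prodSF; apply: eq_map => j.
by rewrite /factor /=; case: odd.
Qed.

Lemma ev_factor0 k w j : ev k (factor w j 0) = 1.
Proof. exact: ev_signed_pl0. Qed.

Lemma D_factor k w j m :
  'D (ev k (factor w j.+1 m.+1)) = ev k (factor w j.+1 m) * psum k 1 ^+ j.
Proof. by rewrite D_signed_pl D_signed_ell. Qed.

(** Multiplicity 0 gives a factor 1, so the range may be enlarged. A common [M] allows [lam] to be
    compared with [lam] minus a part. *)
Lemma ev_chG k w lam M : (sumn lam <= M)%N ->
  ev k (chG w lam) = \prod_(j <- iota 1 M) ev k (factor w j (count_mem j lam)).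
Proof.
move=> leM; rewrite ev_prod big_map -(subnKC leM) iotaD big_cat /=.
rewrite [X in _ * X]big1_seq ?mulr1 // => j /= jM.
rewrite (count_memPn _) ?ev_factor0 //; apply/negP => /mem_sumn.
by move: jM; rewrite mem_iota add1n => /andP[lt _]; rewrite leqNgt lt.
Qed.

Lemma D_prod (I : eqType) k (s : seq I) (g : I -> {mpoly algC[k.+2]}) : uniq s ->
  'D (\prod_(j <- s) g j) = \sum_(j <- s) 'D (g j) * \prod_(l <- s | l != j) g l.
Proof.
elim: s => [|x s IH] /=; first by rewrite !big_nil -mpolyC1 mderivC.
case/andP=> xs /IH e; rewrite !big_cons mderivM e eqxx /=; congr (_ * _ + _).
  rewrite big_seq [RHS]big_seq_cond; apply: eq_bigl => l;
    case: (boolP (l \in s)) => //= ls.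
  by apply/esym; apply: contraNneq xs => <-.
rewrite mulr_sumr; apply: eq_big_seq => j js; rewrite big_cons mulrCA.
by rewrite (_ : x != j) //; apply: contraNneq xs => ->.
Qed.

(** In the Leibniz sum the factor of index j = l+1 loses one unit of multiplicity and yields p_1^l;
    indices that are not parts of [lam] have the constant factor 1. *)
Lemma D_chG k w lam M : (sumn lam <= M)%N ->
  'D (ev k (chG w lam)) =
    \sum_(l <- iota 0 M | l.+1 \in lam) psum k 1 ^+ l * ev k (chG w (rem l.+1 lam)).
Proof.
move=> leM; rewrite (ev_chG k w leM) D_prod ?iota_uniq //.
rewrite -[1%N]/(1 + 0)%N iotaDl big_map [RHS]big_mkcond; apply: eq_big_seq => l lM /=.
rewrite add1n; case: ifP => ll; last first.
  by rewrite (count_memPn _) ?ll // ev_factor0 -mpolyC1 mderivC mul0r.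
have leM' : (sumn (rem l.+1 lam) <= M)%N.
  by apply: leq_trans leM; rewrite (perm_sumn (perm_to_rem ll)) /= leq_addl.
rewrite (ev_chG k w leM') (seq.permP (perm_to_rem ll)) /= eqxx add1n D_factor.
rewrite [in RHS](bigD1_seq l.+1) ?iota_uniq //=; last by move: lM; rewrite !mem_iota.
rewrite [_ * psum _ _ ^+ _]mulrC -mulrA; congr (_ * (_ * _)).
rewrite -[iota 1 M]/(iota (1 + 0) M) iotaDl !big_map; apply: eq_bigr => j jl.
by rewrite (seq.permP (perm_to_rem ll)) /= eq_sym (negbTE jl).
Qed.

(** Exchanging the sums groups the terms by the removed part l+1, and [hatLam_rem] identifies what
    remains. *)
Lemma D_chHatG k w i m : 'D (ev k (chHatG w i m)) =
  \sum_(l < m | (0 < l <= i)%N) psum k 1 ^+ l * ev k (chHatG w (i - l) (m - l.+1)).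
Proof.
rewrite ev_flatten raddf_sum /=.
under eq_big_seq => lam lamH.
  have /(D_chG k w) -> : (sumn lam <= m)%N.
    by move: lamH; rewrite hatLamP => /and5P[_ _ _ /eqP ->].
  over.
rewrite (exchange_big_dep xpredT) //= -(big_mkord (fun l => 0 < l <= i)%N
  (fun l => psum k 1 ^+ l * ev k (chHatG w (i - l) (m - l.+1)))).
rewrite /index_iota subn0 [RHS]big_mkcond; apply: eq_big_seq => l;
  rewrite mem_iota => /andP[_ lm].
case: ifP => li; last first.
  rewrite big_seq_cond big1 // => lam /andP[/hatLam_rank h /h[]].
  by rewrite li.
case/andP: li => l0 li; rewrite -mulr_sumr ev_flatten; congr (_ * _).
rewrite -(perm_big _ (hatLam_rem l0 li lm)) /= big_map big_filter; exact: eq_bigl.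
Qed.

Lemma D_chHatG_rec k w i m : 'D (ev k (chHatG w i.+1 m.+2)) =
  psum k 1 * ('D (ev k (chHatG w i m.+1)) + ev k (chHatG w i m)).
Proof.
rewrite !D_chHatG big_mkcond big_ord_recl /= add0r -big_mkcond /=.
(* The terms l = 0 are excluded on both sides. On the left l = 1 gives p_1 H^i_m, and each l >= 2
   matches the term l-1 on the right. *)
rewrite big_mkcond big_ord_recl [in RHS]big_mkcond [in RHS]big_ord_recl /= add0r addrC
  mulrDr.
rewrite [bump 0 0]/= !subSS !subn0; congr (_ + _).
rewrite [RHS]mulr_sumr; apply: eq_bigr => l _; rewrite /bump /= !add1n ltnS.
by case: ifP => _; rewrite ?mulr0 // mulrA -exprS !subSS.
Qed.

(** * From coefficients back to class functions *)

(* The number usually written z_mu when mu is a partition of k. *)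
Definition zee N k (mu : seq nat) : algC :=
  #|SymN N k|%:R / #|[set t in SymN N k | perm_eq (ctype k t) mu]|%:R.

Lemma zee_perm N k mu nu : perm_eq mu nu -> zee N k mu = zee N k nu.
Proof.
move/permPr=> e; congr (_ / _%:R); apply: eq_card => t.
by rewrite [LHS]in_set [RHS]in_set e.
Qed.

Lemma cfOfE (gT : finGroupType) (G : {group gT}) (F : gT -> algC) s :
    (forall x y, x \in G -> y \in G -> F (x ^ y)%g = F x) -> s \in G ->
  cfOf G F s = F s.
Proof.
move=> FJ sG; rewrite sum_cfunE (bigD1 (s ^: G)%g) ?mem_classes //= big1 => [|A].
  rewrite cfunE cfun_classE sG class_refl mulr1 addr0.
  by have [y yG ->] := repr_class G s; apply: FJ.
case/andP=> /imsetP[x xG ->] ne; rewrite cfunE cfun_classE xG /=.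
case: (boolP (s \in x ^: G)%g) => [/class_eqP e|]; last by rewrite mulr0.
by rewrite e eqxx in ne.
Qed.

Lemma chInvE N k f s : s \in SymN N k ->
  chInv N k f s = zee N k (ctype k s) * coefSF f (ctype k s).
Proof.
move=> sS; rewrite cfOfE // => [|x y xS yS]; first by rewrite mulrAC.
have e := ctypeJ x yS; rewrite (coefSF_perm f e); congr (_ / _%:R).
by apply: eq_card => t; rewrite [LHS]in_set [RHS]in_set (permPr e).
Qed.

(** Double counting applied to the indicator function of the cycle type [1%N :: mu]. *)
Lemma zeeS N k mu : (k < N)%N ->
  zee N k.+1 (1%N :: mu) = (count_mem 1%N mu).+1%:R * zee N k mu.
Proof.
move=> kN; rewrite /zee.
set c' := #|[set _ in SymN N k.+1 | _]|; set c := #|[set _ in SymN N k | _]|.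
have e : ((count_mem 1%N mu).+1 * c' * #|SymN N k| = c * #|SymN N k.+1|)%N.
  pose F (t : {perm 'I_N}) : nat := perm_eq (ctype k.+1 t) (1%N :: mu).
  have FJ s y : s \in SymN N k.+1 -> y \in SymN N k.+1 -> F (s ^ y)%g = F s.
    by move=> _ yS; rewrite /F (permPl (ctypeJ s yS)).
  have mn (a b : nat) : (a *+ b)%R = (a * b)%N.
    by elim: b => [|b IH]; rewrite ?mulr0n ?muln0 // mulrS IH mulnS.
  have := sum_SymN_fixed kN FJ; rewrite !mn; under eq_bigr => s _ do rewrite mn.
  move=> e.
  transitivity ((\sum_(s in SymN N k.+1) F s * count_mem 1%N (ctype k.+1 s))
                  * #|SymN N k|)%N.
    congr (_ * _)%N; rewrite /c' -sum1_card big_distrr /=.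
    rewrite (eq_bigl (fun t => (t \in SymN N k.+1) && (perm_eq (ctype k.+1 t)
      (1%N :: mu)))) => [|t]; last by rewrite [LHS]in_set.
    rewrite big_mkcondr; apply: eq_bigr => t _; rewrite /F; case: ifP => // /seq.permP ->.
    by rewrite /= muln1 mul1n add1n.
  rewrite [LHS]e; congr (_ * _)%N; rewrite /c -sum1_card.
  rewrite [RHS](eq_bigl (fun t => (t \in SymN N k) && (perm_eq (ctype k t) mu))) =>
    [|t]; last by rewrite [LHS]in_set.
  rewrite [RHS]big_mkcondr; apply: eq_bigr => t tS;
    rewrite /F (permPl (ctypeS kN tS)) perm_cons.
  by case: perm_eq.
have S0 l : #|SymN N l| != 0%N by rewrite -lt0n cardG_gt0.
(* If no element of S_k has type [mu], both class sizes are 0, and both sides vanish because the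
   inverse of 0 is 0. *)
have [c0|c0] := eqVneq c 0%N.
  have -> : c' = 0%N by move/eqP: e;
    rewrite c0 mul0n !muln_eq0 /= (negbTE (S0 k)) orbF => /eqP.
  by rewrite c0 invr0 !mulr0.
have c'0 : c' != 0%N.
  by apply: contraNneq c0 => c'0; move/esym/eqP: e;
    rewrite c'0 muln0 mul0n muln_eq0 (negbTE (S0 _)) orbF.
rewrite mulrA; apply/eqP; rewrite eqr_div ?pnatr_eq0 //.
by rewrite -!natrM mulnC -e mulnAC.
Qed.

(** Both sides are evaluated at an element of cycle type mu: restriction becomes D through the
    factor in [zeeS], and induction becomes multiplication by p_1 through the count in
    [card_SymN_conj]. *)
Lemma recursion_chInv m w i :
  'Res[SymN m.+2 m.+1] (chInv m.+2 m.+2 (chHatG w i.+1 m.+2))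
    = 'Ind[SymN m.+2 m.+1] ('Res[SymN m.+2 m] (chInv m.+2 m.+1 (chHatG w i m.+1))
                            + chInv m.+2 m (chHatG w i m)).
Proof.
apply/cfun_inP => s sS; set N := m.+2.
have sub1 := SymN_sub N (leqnSn m.+1); have sub0 := SymN_sub N (leqnSn m).
have mN : (m < N)%N by rewrite /N ltnS leqnSn.
rewrite cfResE // chInvE ?(subsetP sub1) // cfIndE //.
set mu := ctype m.+1 s.
have pmu : perm_eq (ctype m.+2 s) (1%N :: mu) by apply: ctypeS.
(* Cycle lengths are at most [N], so [N.+2] variables see every coefficient involved. *)
have bounded nu : {subset nu <= mu} -> all (fun x => x < N.+2)%N nu.
  by move=> h; apply/allP => x /h /ctype_le xN; rewrite !ltnS (leq_trans xN) ?leqnSn.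
rewrite (zee_perm _ _ pmu) (coefSF_perm _ pmu) zeeS // -mulrA mulr_natl -mulrnAr.
have -> : coefSF (chHatG w i.+1 N) (1%N :: mu) *+ (count_mem 1%N mu).+1
    = (psum N 1 * ('D (ev N (chHatG w i m.+1)) + ev N (chHatG w i m)))@_(mnm_type N mu).
  by rewrite -D_chHatG_rec coef_D // bounded.
rewrite coef_mulp1.
set c := zee N m.+1 mu * coefSF (chHatG w i m.+1) mu + zee N m (rem 1%N mu) * coefSF
  (chHatG w i m) (rem 1%N mu).
(* Every [y] that conjugates [s] into S_m contributes the same value [c] to the induced
   character. *)
transitivity ((count_mem 1%N mu)%:R * c); last first.
  apply: (mulfI (x := #|SymN N m|%:R)); first by rewrite pnatr_eq0 -lt0n cardG_gt0.
  rewrite [RHS]mulrA mulfV ?mul1r; last by rewrite pnatr_eq0 -lt0n cardG_gt0.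
  rewrite mulrA -natrM mulnC -card_SymN_conj // -sum1_card natr_sum mulr_suml big_mkcond.
  rewrite [RHS]big_mkcond; apply: eq_bigr => y _; rewrite [X in if X then _ else _]in_set.
  case: (boolP (y \in SymN N m.+1)) => //= yS.
  have [syS|syS] := boolP ((s ^ y)%g \in SymN N m); last by rewrite cfun0.
  have pJ : perm_eq (ctype m.+1 (s ^ y)%g) mu by apply: ctypeJ.
  have p0 : perm_eq (ctype m (s ^ y)%g) (rem 1%N mu).
    have := perm_rem 1%N (ctypeS mN syS); rewrite /= perm_sym => /perm_trans; apply.
    exact: perm_rem.
  rewrite mul1r cfunE cfResE // !chInvE ?(subsetP sub0) //.
  by rewrite (zee_perm _ _ pJ) (coefSF_perm _ pJ) (zee_perm _ _ p0) (coefSF_perm _ p0).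
(* Without a fixed point in [0,m], p_1 does not divide p_mu and no conjugate lies in S_m: both sides
   are 0. *)
case: ifP => mu1; last by rewrite (count_memPn _) ?mu1 // mulr0 mul0r.
have prem := perm_to_rem mu1; set nu := rem 1%N mu in prem c *.
have nuk : all (fun x => x < N.+2)%N nu by apply: bounded => x; apply: mem_rem.
rewrite mcoeffD coef_D // -ev_coef // (seq.permP prem) /= add1n.
rewrite /c !mulrDr -(coefSF_perm _ prem); congr (_ + _).
  by rewrite mulrnAr mulr_natl.
by rewrite mulrA -zeeS // -(zee_perm _ _ prem).
Qed.

(* Everything lives in {perm 'I_n}; S_m (m <= n) is SymN n m, the pointwise
   stabiliser of {m,..,n-1}.  Restriction S_n -> S_(n-1) is 'Res[SymN n (n-1)],
   induction S_(n-2) -> S_(n-1) is 'Ind[SymN n (n-1)].  Isomorphism of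
   representations = equality of characters. *)
Theorem theorem1p4 (n i : nat) (hn : (2 <= n)%N) (hi : (1 <= i)%N) :
  'Res[SymN n n.-1] (HatLie n i n)
    = 'Ind[SymN n n.-1] ('Res[SymN n n.-2] (HatLie n i.-1 n.-1) + HatLie n i.-1 n.-2)
  /\
  'Res[SymN n n.-1] (HatW n i n)
    = 'Ind[SymN n n.-1] ('Res[SymN n n.-2] (HatW n i.-1 n.-1) + HatW n i.-1 n.-2).
Proof.
case: n hn => [//|[//|m]] _; case: i hi => [//|i] _; split=> /=.
  by rewrite /HatLie -!chHatG_Lie; apply: recursion_chInv.
by rewrite /HatW -!chHatG_W; apply: recursion_chInv.
Qed.
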